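(* For all $n\ge1$ and $d\ge3$, $m^*_{d,n}=\left\lfloor\frac{(d-1)(n-1)}{2}\right\rfloor$, where $m^*_{d,n}$ is defined in the context.
   Context: $S_n$ is the set of permutations of $\{0,\dots,n-1\}$ in one-line notation. $S^d_n$ is the set of $(d-1)$-tuples $\Pi=(\pi^2,\dots,\pi^d)$ of elements of $S_n$, with elements (columns) $\Pi_j=(\pi^2_j,\dots,\pi^d_j)^T$. The (sum) level is $\mathrm{lev}(\Pi_j)=\pi^2_j+\dots+\pi^d_j$ and $\mathrm{lev}_{\min}(\Pi)=\min_j\mathrm{lev}(\Pi_j)$. Define $m^*_{d,n}=\max\{\mathrm{lev}_{\min}(\Pi):\Pi\in S^d_n\}$. *)

(* Defs.v *)
From mathcomp Require Import all_boot all_fingroup.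

Set Implicit Arguments.
Unset Strict Implicit.
Unset Printing Implicit Defensive.

(* S^d_n, the (d-1)-tuples (pi^2, ..., pi^d) of permutations of {0, ..., n-1}:
   the permutation pi^k is the component of index k - 2. *)
Definition perm_tuples (d n : nat) : finType := (d.-1).-tuple 'S_n.

Definition lev (d n : nat) (Pi : perm_tuples d n) (j : 'I_n) : nat :=
  \sum_(i < d.-1) (tnth Pi i j : nat).

(* minn has no neutral element on nat; (d-1)(n-1) bounds every level from above
   (lev_le), so for n > 0 the result is the true minimum of the levels
   (lev_minP). *)
Definition lev_min (d n : nat) (Pi : perm_tuples d n) : nat :=
  \big[minn/d.-1 * n.-1]_(j < n) lev Pi j.

Definition mstar (d n : nat) : nat :=
  \max_(Pi : perm_tuples d n) lev_min Pi.

Lemma lev_le (d n : nat) (Pi : perm_tuples d n) (j : 'I_n) :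
  lev Pi j <= d.-1 * n.-1.
Proof.
rewrite /lev; apply: (@leq_trans (\sum_(i < d.-1) n.-1)).
  apply: leq_sum => i _; case: n Pi j => [|n] Pi j; first by case: j.
  by rewrite -ltnS ltn_ord.
by rewrite sum_nat_const card_ord.
Qed.

Lemma lev_minP (d n : nat) (Pi : perm_tuples d n) : 0 < n ->
  (exists j, lev_min Pi = lev Pi j) /\ (forall j, lev_min Pi <= lev Pi j).
Proof.
move=> n_gt0.
have lower j : lev_min Pi <= lev Pi j.
  rewrite /lev_min; elim: (index_enum _) (mem_index_enum j) => // k s IHs.
  rewrite inE big_cons geq_min => /predU1P[->|/IHs->]; first by rewrite leqnn.
  by rewrite orbT.
split=> //.
have [|E] : (exists j, lev_min Pi = lev Pi j) \/ lev_min Pi = d.-1 * n.-1.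
- rewrite /lev_min; apply: (big_ind (fun x =>
    (exists j, x = lev Pi j) \/ x = d.-1 * n.-1)); first by right.
    by move=> x y Hx Hy; rewrite /minn; case: ifP.
  by move=> j _; left; exists j.
- by [].
by exists (Ordinal n_gt0); apply/eqP; rewrite eqn_leq lower E lev_le.
Qed.

(* Main.v *)
Require Import Defs.
From mathcomp Require Import all_boot all_fingroup.
From mathcomp Require Import zify.

(** Every permutation sums to [n(n-1)/2], so the [n] levels average to
    [(d-1)(n-1)/2], which bounds the minimum. Conversely, a permutation paired
    with its reversal adds the constant [n-1] to all levels; this settles the
    case of an even number of permutations, and for an odd number one starts
    from three permutations whose levels differ by at most one. *)

Lemma sum_perm_ord (n : nat) (s : 'S_n) : \sum_(j < n) s j = 'C(n, 2).
Proof.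
rewrite -bin2_sum big_mkord.
by rewrite [RHS](reindex_inj (@perm_inj _ s)).
Qed.

Lemma lev_min_upper (d n : nat) (Pi : perm_tuples d n) :
  0 < n -> lev_min Pi <= (d.-1 * n.-1) %/ 2.
Proof.
move=> n_gt0; have [_ lower] := lev_minP Pi n_gt0.
have: \sum_(j < n) lev_min Pi <= \sum_(j < n) lev Pi j by apply: leq_sum.
rewrite sum_nat_const card_ord exchange_big /=.
under [X in _ <= X]eq_bigr do rewrite sum_perm_ord.
rewrite sum_nat_const card_ord => le_sum.
(* Doubling turns the averaged bound into one where the factor [n] cancels. *)
have bin2_double : 'C(n, 2) * 2 = n * n.-1 by rewrite (bin_ffact n 2) ffactnS ffactn1.
rewrite leq_divRL // -(leq_pmul2l n_gt0) mulnA.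
by rewrite [X in _ <= X]mulnCA -bin2_double mulnA leq_mul2r.
Qed.

Lemma perm_of_nat (n : nat) (f : nat -> nat) :
    (forall j, j < n -> f j < n) ->
    (forall i j, i < n -> j < n -> f i = f j -> i = j) ->
  exists s : 'S_n, forall j : 'I_n, s j = f j :> nat.
Proof.
move=> f_lt f_inj; pose g (j : 'I_n) := Ordinal (f_lt j (ltn_ord j)).
have g_inj : injective g by move=> i j [] /f_inj/val_inj; apply.
by exists (perm g_inj) => j; rewrite permE.
Qed.

(* With [N = n - 1], the levels [j + b j + c j] are [N + N./2] at even [j] and
   [N + 1 + N.-1./2] at odd [j]. *)
Lemma three_perms (n : nat) :
  exists s : seq 'S_n, size s = 3 /\
    forall j : 'I_n, (3 * n.-1)./2 <= \sum_(p <- s) p j.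
Proof.
(* In [b], even [j] run down the upper half of the values and odd [j] the lower half; [c] swaps the
   halves. Raising [j] by 2 lowers each by 1. *)
have [||b bE] := @perm_of_nat n
  (fun j => if odd j then n.-1.-1./2 - j./2 else n.-1 - j./2).
- by move=> j; case: ifP; lia.
- by move=> i j; case: ifP; case: ifP; lia.
have [||c cE] := @perm_of_nat n
  (fun j => if odd j then n.-1 - j./2 else n.-1./2 - j./2).
- by move=> j; case: ifP; lia.
- by move=> i j; case: ifP; case: ifP; lia.
exists [:: 1%g; b; c]; split=> // j.
rewrite !big_cons big_nil perm1 bE cE; have := ltn_ord j.
by case: ifP; lia.
Qed.

(** A single permutation takes the value 0, so [m = 1] fails once [n >= 3]; the odd case must start
    at 3. *)
Lemma balanced_perms (n m : nat) : m != 1 ->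
  exists s : seq 'S_n, size s = m /\
    forall j : 'I_n, (m * n.-1)./2 <= \sum_(p <- s) p j.
Proof.
elim/ltn_ind: m => -[|[|m]] IH // _; first by exists [::]; split.
have [-> | m_neq1] := eqVneq m 1; first exact: three_perms.
have [//|//|s [sz_s le_s]] := IH m.
exists [:: 1%g, perm (@rev_ord_inj n) & s]; split=> [|j]; first by rewrite /= sz_s.
rewrite !big_cons perm1 permE /=.
have := le_s j; have := ltn_ord j; rewrite !mulSn; lia.
Qed.

Theorem theorem4p7 (n d : nat) (hn : 1 <= n) (hd : 3 <= d) :
  mstar d n = ((d - 1) * (n - 1)) %/ 2.
Proof.
rewrite !subn1; apply/eqP; rewrite eqn_leq; apply/andP; split.
  by apply/bigmax_leqP => Pi _; apply: lev_min_upper.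
have [|s [sz_s le_s]] := @balanced_perms n d.-1; first by lia.
pose Pi : perm_tuples d n := tcast sz_s (in_tuple s).
apply: leq_trans (leq_bigmax Pi).
(* The minimum is attained, so bounding one arbitrary level suffices. *)
have [[j ->] _] := lev_minP Pi hn.
have -> : lev Pi j = \sum_(p <- s) p j.
  by rewrite /lev -(big_tuple _ _ Pi predT (fun p : 'S_n => p j : nat)) val_tcast.
by rewrite divn2.
Qed.
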